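(* The system of infinite-valued logic with axioms A1 $=i(x,i(y,x))$, A2 $=i(i(x,y),i(i(y,z),i(x,z)))$, A3 $=i(i(i(x,y),y),i(i(y,x),x))$, A4 $=i(i(n(x),n(y)),i(y,x))$ and condensed detachment as sole rule of inference admits strong double-negation elimination.
   Context: Formulas are terms built from propositional variables using the binary connective $i$ (implication) and the unary connective $n$ (negation). Condensed detachment: from a major premiss $i(A,B)$ and a minor premiss $C$, after renaming variables so that the two premisses share no variables, if $A$ and $C$ are unifiable with most general unifier $\sigma$, infer $B\sigma$. Alphabetic variants of axioms count as axioms, and conclusions may be renamed. A proof is a finite sequence of formulas each an axiom or obtained from earlier lines by the rule; deduced steps are the non-axiom lines. Given a formula $B$, a formula $B^*$ is obtained from $B$ by selecting some set of doubly negated subformulas $n(n(q))$ of $B$ and replacing all occurrences of each selected subformula by $q$. A system admits strong double-negation elimination if whenever it proves $B$ and $B^*$ is obtained from $B$ in this way, there is a proof of $B^*$ in the system in which every subformula of the form $n(n(t))$ of a deduced step occurs (up to renaming of variables) as a subformula of $B^*$. *)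

(* Defs.v *)
From Stdlib Require Import List Arith.
Import ListNotations.

Inductive form : Type :=
| Var : nat -> form
| Imp : form -> form -> form
| Neg : form -> form.

Fixpoint subst (s : nat -> form) (F : form) : form :=
  match F with
  | Var x => s x
  | Imp A B => Imp (subst s A) (subst s B)
  | Neg A => Neg (subst s A)
  end.

Definition rename (f : nat -> nat) (F : form) : form :=
  subst (fun x => Var (f x)) F.

Definition injective_nat (f : nat -> nat) : Prop :=
  forall x y, f x = f y -> x = y.

Definition variant (F G : form) : Prop :=
  exists f, injective_nat f /\ G = rename f F.

Fixpoint occurs (x : nat) (F : form) : Prop :=
  match F with
  | Var y => x = y
  | Imp A B => occurs x A \/ occurs x B
  | Neg A => occurs x A
  end.

Inductive subform : form -> form -> Prop :=
| sub_refl : forall F, subform F F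
| sub_impl : forall G A B, subform G A -> subform G (Imp A B)
| sub_impr : forall G A B, subform G B -> subform G (Imp A B)
| sub_neg  : forall G A, subform G A -> subform G (Neg A).

Definition mgu (s : nat -> form) (A C : form) : Prop :=
  subst s A = subst s C /\
  forall t, subst t A = subst t C ->
    exists r, forall x, t x = subst r (s x).

Definition cd (M C D : form) : Prop :=
  exists f1 f2 A B s,
    injective_nat f1 /\ injective_nat f2 /\
    rename f1 M = Imp A B /\
    (forall x, occurs x (Imp A B) -> ~ occurs x (rename f2 C)) /\
    mgu s A (rename f2 C) /\
    variant (subst s B) D.

Definition x0 := Var 0.
Definition y0 := Var 1.
Definition z0 := Var 2.

Definition A1 := Imp x0 (Imp y0 x0).
Definition A2 := Imp (Imp x0 y0) (Imp (Imp y0 z0) (Imp x0 z0)).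
Definition A3 := Imp (Imp (Imp x0 y0) y0) (Imp (Imp y0 x0) x0).
Definition A4 := Imp (Imp (Neg x0) (Neg y0)) (Imp y0 x0).

Definition axioms : list form := [A1; A2; A3; A4].

Definition is_axiom (F : form) : Prop :=
  exists A, In A axioms /\ variant A F.

(* justification of a proof line: axiom, or CD from earlier lines i (major)
   and j (minor) *)
Inductive just : Type :=
| JAx : just
| JCD : nat -> nat -> just.

Definition line_ok (prev : list form) (l : form * just) : Prop :=
  match snd l with
  | JAx => is_axiom (fst l)
  | JCD i j => exists M C, nth_error prev i = Some M /\
                           nth_error prev j = Some C /\ cd M C (fst l)
  end.

Definition valid_proof (P : list (form * just)) : Prop :=
  forall k l, nth_error P k = Some l -> line_ok (map fst (firstn k P)) l.

Definition proof_of (P : list (form * just)) (F : form) : Prop :=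
  valid_proof P /\ exists j, nth_error P (length P - 1) = Some (F, j).

Definition provable (F : form) : Prop := exists P, proof_of P F.

Fixpoint star (S : form -> bool) (F : form) : form :=
  match F with
  | Var x => Var x
  | Imp A B => Imp (star S A) (star S B)
  | Neg A =>
      match A with
      | Neg q => if S (Neg (Neg q)) then star S q else Neg (star S A)
      | _ => Neg (star S A)
      end
  end.

Definition selection (S : form -> bool) (B : form) : Prop :=
  forall F, S F = true -> (exists q, F = Neg (Neg q)) /\ subform F B.

Definition nn_controlled (P : list (form * just)) (Bs : form) : Prop :=
  forall k F i j, nth_error P k = Some (F, JCD i j) ->
    forall G t, subform G F -> G = Neg (Neg t) ->
      exists H, subform H Bs /\ variant H G.

Definition admits_strong_dne : Prop :=
  forall B, provable B ->
    forall S, selection S B ->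
      exists P, proof_of P (star S B) /\ nn_controlled P (star S B).

(* Main.v *)
Require Import Defs.
From Stdlib Require Import List Arith Lia Bool.
Import ListNotations.

(** Condensed detachment derives strictly more general formulas than detachment
on instances, so the work lies in recovering instances.  If [i(a,a)] is
derivable, condensed detachment with minor premiss [F] turns it into [a]
whenever [a] is an instance of [F]; hence it suffices to derive [i(a,a)] for
every [a] whose double negations are permitted.  This goes by induction on [a]:
[i(b,c)] is first obtained with the variables of [b] and [c] kept apart.  To
identify two of its variables [x] and [y], put [e(x) = i(i(x,x),x)] and derive
[i(e(y), i(e(x), i(a,a)))]; the theorem [i(i(p,i(p,i(q,q))),i(q,q))], a
consequence of A3, then forces [e(x) = e(y)].

A proof of [B] is thus a derivation by substitution and detachment, to which
[star] applies line by line.  A4 survives in the form [i(i(a,b),i(b',a'))],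
where one of [a], [a'] is the negation of the other and likewise for [b], [b'].
Applying [star] once more, now to every double negation that is not a
subformula of [B*], fixes [B*] and leaves only permitted double negations. *)

(** * Formulas, substitution and alphabetic variants *)

Lemma form_eq_dec (F G : form) : {F = G} + {F <> G}.
Proof. decide equality; apply Nat.eq_dec. Defined.

(** The negation case also reaches two negations down, as the recursion of [star] does at
    n(n(q)). *)
Lemma form_neg_ind (P : form -> Prop) :
  (forall x, P (Var x)) ->
  (forall A B, P A -> P B -> P (Imp A B)) ->
  (forall A, P A -> (forall q, A = Neg q -> P q) -> P (Neg A)) ->
  forall F, P F.
Proof.
  intros HV HI HN F.
  enough (P F /\ forall q, F = Neg q -> P q) by tauto.
  induction F as [x|A [IA _] B [IB _]|A [IA IA']]; split; auto;
    try (intros q E; discriminate).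
  intros q E; injection E as <-; exact IA.
Qed.

Lemma subst_ext (s t : nat -> form) (F : form) :
  (forall x, occurs x F -> s x = t x) -> subst s F = subst t F.
Proof. induction F; simpl; intros H; f_equal; auto. Qed.

Lemma subst_ext_inv (s t : nat -> form) (F : form) :
  subst s F = subst t F -> forall x, occurs x F -> s x = t x.
Proof.
  induction F; simpl; intros H x Hx.
  - now subst.
  - injection H as H1 H2; destruct Hx; auto.
  - injection H as H; auto.
Qed.

Lemma subst_subst (s t : nat -> form) (F : form) :
  subst s (subst t F) = subst (fun x => subst s (t x)) F.
Proof. induction F; simpl; congruence. Qed.

Lemma subst_Var (F : form) : subst Var F = F.
Proof. induction F; simpl; congruence. Qed.

Lemma subst_id (s : nat -> form) (F : form) :
  (forall x, occurs x F -> s x = Var x) -> subst s F = F.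
Proof. intros H; rewrite <- (subst_Var F) at 2; now apply subst_ext. Qed.

Lemma subst_rename (s : nat -> form) (f : nat -> nat) (F : form) :
  subst s (rename f F) = subst (fun x => s (f x)) F.
Proof. unfold rename; now rewrite subst_subst. Qed.

Lemma rename_rename (f g : nat -> nat) (F : form) :
  rename g (rename f F) = rename (fun x => g (f x)) F.
Proof. unfold rename at 1; now rewrite subst_rename. Qed.

Lemma occurs_subst (s : nat -> form) (y : nat) (F : form) :
  occurs y (subst s F) <-> exists x, occurs x F /\ occurs y (s x).
Proof.
  induction F as [x|A IA B IB|A IA]; simpl.
  - split; [eauto|now intros (z & -> & H)].
  - rewrite IA, IB; firstorder.
  - exact IA.
Qed.

Lemma occurs_rename (f : nat -> nat) (y : nat) (F : form) :
  occurs y (rename f F) <-> exists x, occurs x F /\ y = f x.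
Proof. apply occurs_subst. Qed.

Fixpoint occursb (x : nat) (F : form) : bool :=
  match F with
  | Var y => x =? y
  | Imp A B => occursb x A || occursb x B
  | Neg A => occursb x A
  end.

Lemma occursbP (x : nat) (F : form) : reflect (occurs x F) (occursb x F).
Proof.
  apply iff_reflect; induction F; simpl.
  - symmetry; apply Nat.eqb_eq.
  - rewrite orb_true_iff; tauto.
  - assumption.
Qed.

Fixpoint bound (F : form) : nat :=
  match F with
  | Var x => S x
  | Imp A B => max (bound A) (bound B)
  | Neg A => bound A
  end.

Lemma occurs_bound (x : nat) (F : form) : occurs x F -> x < bound F.
Proof. induction F; simpl; intros H; [lia|destruct H as [H|H]|]; intuition lia. Qed.

Lemma variant_trans (F G H : form) : variant F G -> variant G H -> variant F H.
Proof.
  intros (f & Hf & ->) (g & Hg & ->).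
  exists (fun x => g (f x)); split; [|apply rename_rename].
  intros x y E; auto.
Qed.

Lemma variant_refl (F : form) : variant F F.
Proof.
  exists (fun x => x); split; [now intros x y|].
  unfold rename; symmetry; apply subst_Var.
Qed.

(** [variant] asks for injectivity on all of nat: variables outside [F] are sent to [K] and beyond,
    clear of the images of those in [F]. *)
Lemma variant_rename_on (f : nat -> nat) (F : form) :
  (forall x y, occurs x F -> occurs y F -> f x = f y -> x = y) ->
  variant F (rename f F).
Proof.
  intros Hf.
  set (K := bound (rename f F)).
  assert (HK : forall x, occurs x F -> f x < K).
  { intros x Hx; apply occurs_bound, occurs_rename; eauto. }
  exists (fun x => if occursb x F then f x else x + K); split.
  - intros x y.
    destruct (occursbP x F) as [Hx|Hx], (occursbP y F) as [Hy|Hy]; intros E.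
    + auto.
    + specialize (HK x Hx); lia.
    + specialize (HK y Hy); lia.
    + lia.
  - apply subst_ext; intros x Hx.
    now destruct (occursbP x F).
Qed.

(** * Condensed detachment with explicit unifiers *)

Lemma even_div2_double (x : nat) :
  Nat.even (2 * x) = true /\ Nat.div2 (2 * x) = x.
Proof. split; [apply Nat.even_even|apply Nat.div2_double]. Qed.

Lemma even_div2_succ_double (x : nat) :
  Nat.even (S (2 * x)) = false /\ Nat.div2 (S (2 * x)) = x.
Proof.
  split; [|apply Nat.div2_succ_double].
  rewrite Nat.even_succ; apply Nat.odd_even.
Qed.

(** Even numbers encode the variables of the major premiss and odd numbers those of the minor, so
    [s1] and [s2] merge into one substitution. Since [mgu] quantifies over all variables, those in
    neither premiss become distinct variables from [K] on. *)
Lemma cd_intro (A B C D : form) (s1 s2 : nat -> form) :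
  subst s1 A = subst s2 C ->
  (forall t1 t2, subst t1 A = subst t2 C ->
     exists r, (forall x, occurs x (Imp A B) -> t1 x = subst r (s1 x)) /\
               (forall x, occurs x C -> t2 x = subst r (s2 x))) ->
  variant (subst s1 B) D -> cd (Imp A B) C D.
Proof.
  intros E G HD.
  set (K := max (bound (subst s1 (Imp A B))) (bound (subst s2 C))).
  set (s := fun v =>
    if Nat.even v
    then if occursb (Nat.div2 v) (Imp A B) then s1 (Nat.div2 v) else Var (v + K)
    else if occursb (Nat.div2 v) C then s2 (Nat.div2 v) else Var (v + K)).
  assert (Se : forall x, s (2 * x) =
     if occursb x (Imp A B) then s1 x else Var (2 * x + K)).
  { intros x; unfold s; destruct (even_div2_double x) as [-> ->]; reflexivity. }
  assert (So : forall x, s (S (2 * x)) =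
     if occursb x C then s2 x else Var (S (2 * x) + K)).
  { intros x; unfold s; destruct (even_div2_succ_double x) as [-> ->]; reflexivity. }
  assert (SA : subst s (rename (fun x => 2 * x) A) = subst s1 A).
  { rewrite subst_rename; apply subst_ext; intros x Hx; rewrite Se.
    destruct (occursbP x (Imp A B)) as [|H]; [auto|destruct H; now left]. }
  assert (SB : subst s (rename (fun x => 2 * x) B) = subst s1 B).
  { rewrite subst_rename; apply subst_ext; intros x Hx; rewrite Se.
    destruct (occursbP x (Imp A B)) as [|H]; [auto|destruct H; now right]. }
  assert (SC : subst s (rename (fun x => S (2 * x)) C) = subst s2 C).
  { rewrite subst_rename; apply subst_ext; intros x Hx; rewrite So.
    now destruct (occursbP x C). }
  exists (fun x => 2 * x), (fun x => S (2 * x)),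
    (rename (fun x => 2 * x) A), (rename (fun x => 2 * x) B), s.
  split; [intros x y H; lia|].
  split; [intros x y H; lia|].
  split; [reflexivity|].
  split.
  { change (Imp (rename (fun x => 2 * x) A) (rename (fun x => 2 * x) B))
      with (rename (fun x => 2 * x) (Imp A B)).
    intros x H1 H2; apply occurs_rename in H1, H2.
    destruct H1 as (u & _ & H1), H2 as (v & _ & H2); lia. }
  split; [|now rewrite SB].
  split; [now rewrite SA, SC|].
  intros t Ht; rewrite !subst_rename in Ht.
  destruct (G _ _ Ht) as (r & R1 & R2).
  exists (fun w => if w <? K then r w else t (w - K)).
  assert (Hlow : forall F, bound F <= K ->
     subst (fun w => if w <? K then r w else t (w - K)) F = subst r F).
  { intros F HF; apply subst_ext; intros w Hw; apply occurs_bound in Hw.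
    destruct (Nat.ltb_spec w K); [auto|lia]. }
  assert (Hhigh : forall v, subst (fun w => if w <? K then r w else t (w - K))
     (Var (v + K)) = t v).
  { intros v; simpl; destruct (Nat.ltb_spec (v + K) K); [lia|f_equal; lia]. }
  assert (HB : forall u F x, occurs x F -> bound (u x) <= bound (subst u F)).
  { intros u F x; induction F; simpl; intros H; [now subst|destruct H as [H|H]|];
      intuition lia. }
  intros v; destruct (Nat.Even_or_Odd v) as [[x ->]|[x ->]].
  - rewrite Se; destruct (occursbP x (Imp A B)) as [H|H]; [|now rewrite Hhigh].
    rewrite Hlow; [auto|]; apply (HB s1) in H; unfold K; lia.
  - rewrite Nat.add_1_r, So; destruct (occursbP x C) as [H|H]; [|now rewrite Hhigh].
    rewrite Hlow.
    + apply (R2 x H).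
    + apply (HB s2) in H; unfold K; lia.
Qed.

(** Only the minor premiss is instantiated; a unifier is determined by its values on the major
    premiss, where the identity serves. *)
Lemma cd_instance (A B : form) (s : nat -> form) : cd (Imp (subst s A) B) A B.
Proof.
  apply cd_intro with (s1 := Var) (s2 := s).
  - apply subst_Var.
  - intros t1 t2 E; exists t1; split; [reflexivity|].
    rewrite subst_subst in E; apply eq_sym in E.
    exact (subst_ext_inv _ _ _ E).
  - rewrite subst_Var; apply variant_refl.
Qed.

(* [s] on the variables of [A]; the others are moved past [K], hence fresh for
   formulas with bound at most [K]. *)
Definition shift_off (A : form) (s : nat -> form) (K x : nat) : form :=
  if occursb x A then s x else Var (x + K).

(** Dual to [cd_instance]: the antecedent is matched onto an unchanged minor premiss, and variables
    of [B] absent from [A] stay uninstantiated. *)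
Lemma cd_match (A B : form) (s : nat -> form) (K : nat) :
  bound (subst s A) <= K ->
  cd (Imp A B) (subst s A) (subst (shift_off A s K) B).
Proof.
  intros HK.
  assert (HA : subst (shift_off A s K) A = subst s A).
  { apply subst_ext; intros x Hx; unfold shift_off; now destruct (occursbP x A). }
  apply cd_intro with (s1 := shift_off A s K) (s2 := Var).
  - now rewrite HA, subst_Var.
  - intros t1 t2 E.
    exists (fun w => if w <? K then t2 w else t1 (w - K)); split.
    + intros x _; unfold shift_off; destruct (occursbP x A) as [Hx|Hx].
      * rewrite subst_subst in E; rewrite (subst_ext_inv _ _ _ E x Hx).
        apply subst_ext; intros w Hw.
        assert (Hw' : occurs w (subst s A)) by (apply occurs_subst; eauto).
        apply occurs_bound in Hw'; destruct (Nat.ltb_spec w K); [auto|lia].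
      * simpl; destruct (Nat.ltb_spec (x + K) K); [lia|f_equal; lia].
    + intros w Hw; apply occurs_bound in Hw; simpl.
      destruct (Nat.ltb_spec w K); [auto|lia].
  - apply variant_refl.
Qed.

(** * A sound unification procedure *)

Definition single (x : nat) (F : form) (y : nat) : form :=
  if y =? x then F else Var y.

Definition unifies (s : nat -> form) (E : list (form * form)) : Prop :=
  forall p, In p E -> subst s (fst p) = subst s (snd p).

Lemma unifies_cons s a b E :
  unifies s ((a, b) :: E) <-> subst s a = subst s b /\ unifies s E.
Proof.
  split.
  - intros H; split; [apply (H (a, b)); now left|intros p Hp; apply H; now right].
  - intros [H1 H2] p [<-|Hp]; auto.
Qed.

Definition subst_eqs (s : nat -> form) (E : list (form * form)) :=
  map (fun p => (subst s (fst p), subst s (snd p))) E.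

Fixpoint unify (fuel : nat) (E : list (form * form)) : option (nat -> form) :=
  match fuel with
  | 0 => None
  | S n =>
    let bind x F E' :=
      if occursb x F then None
      else match unify n (subst_eqs (single x F) E') with
           | Some s => Some (fun v => subst s (single x F v))
           | None => None
           end in
    match E with
    | [] => Some Var
    | (Imp A B, Imp A' B') :: E' => unify n ((A, A') :: (B, B') :: E')
    | (Neg A, Neg A') :: E' => unify n ((A, A') :: E')
    | (Var x, F) :: E' =>
        if form_eq_dec (Var x) F then unify n E' else bind x F E'
    | (F, Var x) :: E' => bind x F E'
    | _ => None
    end
  end.

(** Taking [t] itself as the mediating substitution, instead of some [r], lets generality compose
    along successive bindings. *)
Definition idempotent_mgu (s : nat -> form) (E : list (form * form)) : Prop :=
  unifies s E /\ forall t, unifies t E -> forall x, t x = subst t (s x).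

Lemma idempotent_mgu_single (x : nat) (F : form) (E : list (form * form)) s :
  ~ occurs x F ->
  idempotent_mgu s (subst_eqs (single x F) E) ->
  idempotent_mgu (fun v => subst s (single x F v)) ((Var x, F) :: E).
Proof.
  intros Hx [U M]; split.
  - apply unifies_cons; split.
    + simpl; unfold single at 1; rewrite Nat.eqb_refl.
      apply subst_ext; intros y Hy; unfold single.
      destruct (Nat.eqb_spec y x) as [->|]; [contradiction|reflexivity].
    + intros p Hp; rewrite <- !subst_subst.
      apply (U (subst (single x F) (fst p), subst (single x F) (snd p))).
      apply (in_map (fun p => (subst _ (fst p), subst _ (snd p)))), Hp.
  - intros t Ht; apply unifies_cons in Ht; destruct Ht as [Hx' Ht]; simpl in Hx'.
    assert (T : forall v, subst t (single x F v) = t v).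
    { intros v; unfold single; destruct (Nat.eqb_spec v x) as [->|]; auto. }
    assert (T' : forall G, subst t (subst (single x F) G) = subst t G).
    { intros G; rewrite subst_subst; apply subst_ext; auto. }
    assert (Ht' : unifies t (subst_eqs (single x F) E)).
    { intros p Hp; apply in_map_iff in Hp; destruct Hp as (q & <- & Hq); simpl.
      rewrite !T'; auto. }
    intros v; rewrite <- (T v) at 1; rewrite subst_subst.
    apply subst_ext; intros w _; apply (M t Ht').
Qed.

Lemma idempotent_mgu_iff s E E' :
  (forall t, unifies t E <-> unifies t E') ->
  idempotent_mgu s E -> idempotent_mgu s E'.
Proof. unfold idempotent_mgu; firstorder. Qed.

Lemma unify_sound (n : nat) : forall E s,
  unify n E = Some s -> idempotent_mgu s E.
Proof.
  induction n as [|n IH]; intros E s H; [discriminate|].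
  assert (Bind : forall x F E' s,
    (if occursb x F then None
     else match unify n (subst_eqs (single x F) E') with
          | Some s => Some (fun v => subst s (single x F v))
          | None => None
          end) = Some s -> idempotent_mgu s ((Var x, F) :: E')).
  { intros x F E' s' H'.
    destruct (occursbP x F) as [|Hx]; [discriminate|].
    destruct (unify n (subst_eqs (single x F) E')) as [u|] eqn:Hu; [|discriminate].
    injection H' as <-; apply idempotent_mgu_single; auto. }
  cbn [unify] in H; destruct E as [|[[x|A B|A] [x'|A' B'|A']] E]; try discriminate H.
  - injection H as <-; split; [intros p []|reflexivity].
  - destruct (form_eq_dec (Var x) (Var x')) as [e|]; [|exact (Bind _ _ _ _ H)].
    apply (idempotent_mgu_iff s E); [|now apply IH].
    intros t; rewrite unifies_cons, e; tauto.
  - exact (Bind _ _ _ _ H).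
  - exact (Bind _ _ _ _ H).
  - apply (idempotent_mgu_iff s ((Var x', Imp A B) :: E)); [|exact (Bind _ _ _ _ H)].
    intros t; rewrite !unifies_cons; intuition congruence.
  - apply (idempotent_mgu_iff s ((A, A') :: (B, B') :: E)); [|now apply IH].
    intros t; rewrite !unifies_cons; simpl; intuition congruence.
  - apply (idempotent_mgu_iff s ((Var x', Neg A) :: E)); [|exact (Bind _ _ _ _ H)].
    intros t; rewrite !unifies_cons; intuition congruence.
  - apply (idempotent_mgu_iff s ((A, A') :: E)); [|now apply IH].
    intros t; rewrite !unifies_cons; simpl; intuition congruence.
Qed.

Fixpoint vars (F : form) : list nat :=
  match F with
  | Var x => [x]
  | Imp A B => vars A ++ vars B
  | Neg A => vars A
  end.

Lemma in_vars (x : nat) (F : form) : occurs x F -> In x (vars F).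
Proof.
  induction F; simpl; auto; rewrite in_app_iff; tauto.
Qed.

Fixpoint index (x : nat) (l : list nat) : nat :=
  match l with
  | [] => 0
  | y :: l' => if x =? y then 0 else S (index x l')
  end.

Lemma index_inj (l : list nat) (x y : nat) :
  In x l -> In y l -> index x l = index y l -> x = y.
Proof.
  induction l as [|z l IH]; simpl; [tauto|].
  destruct (Nat.eqb_spec x z), (Nat.eqb_spec y z); intros Hx Hy E;
    try discriminate; [congruence|].
  injection E; apply IH; intuition congruence.
Qed.

(** Variables are numbered by first occurrence; [nodup] keeps last occurrences, whence the two
    reversals. Evaluated theorems thus get a definite form that computation can compare. *)
Definition normalize (F : form) : form :=
  rename (fun x => index x (rev (nodup Nat.eq_dec (rev (vars F))))) F.

Lemma variant_normalize (F : form) : variant F (normalize F).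
Proof.
  apply variant_rename_on; intros x y Hx Hy; apply index_inj;
    rewrite <- in_rev, nodup_In, <- in_rev; now apply in_vars.
Qed.

Definition detach (M C : form) : option form :=
  match rename (fun x => 2 * x) M with
  | Imp A B =>
      match unify 200 [(A, rename (fun x => S (2 * x)) C)] with
      | Some s => Some (normalize (subst s B))
      | None => None
      end
  | _ => None
  end.

Lemma detach_sound (M C D : form) : detach M C = Some D -> cd M C D.
Proof.
  unfold detach; destruct (rename (fun x => 2 * x) M) as [|A B|] eqn:HM;
    try discriminate.
  destruct (unify _ _) as [s|] eqn:Hs; [|discriminate].
  intros E; injection E as <-.
  apply unify_sound in Hs; destruct Hs as [U G].
  exists (fun x => 2 * x), (fun x => S (2 * x)), A, B, s.
  split; [intros x y H; lia|].
  split; [intros x y H; lia|].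
  split; [exact HM|].
  split.
  { rewrite <- HM; intros x H1 H2; apply occurs_rename in H1, H2.
    destruct H1 as (u & _ & H1), H2 as (v & _ & H2); lia. }
  split; [|apply variant_normalize].
  split; [apply (U _ (or_introl eq_refl))|].
  intros t Ht; exists t; apply G.
  intros p [<-|[]]; exact Ht.
Qed.

(** * Permitted double negations and controlled derivations *)

Definition allowed (Bs G : form) : Prop :=
  exists H, subform H Bs /\ variant H G.

(** Variants are injective renamings, so identifying variables can turn a permitted double negation
    into a forbidden one. *)
Fixpoint ok (Bs F : form) : Prop :=
  match F with
  | Var _ => True
  | Imp A B => ok Bs A /\ ok Bs B
  | Neg A => ok Bs A /\
      match A with
      | Neg _ => allowed Bs (Neg A)
      | _ => True
      end
  end.

Lemma ok_subform (Bs F G : form) : ok Bs F -> subform G F -> ok Bs G.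
Proof. intros H HS; induction HS; simpl in H; intuition. Qed.

Lemma subform_trans (F G H : form) : subform F G -> subform G H -> subform F H.
Proof. intros H1 H2; induction H2; auto using subform. Qed.

Lemma ok_of_subform (Bs F : form) : subform F Bs -> ok Bs F.
Proof.
  induction F as [x|A IA B IB|A IA]; simpl; intros H; auto.
  - split; [apply IA|apply IB]; eapply subform_trans; try exact H;
      auto using subform.
  - split; [apply IA; eapply subform_trans; try exact H; auto using subform|].
    destruct A; auto; exists (Neg (Neg A)); split; [exact H|apply variant_refl].
Qed.

Lemma ok_rename (Bs F : form) (f : nat -> nat) :
  (forall x y, occurs x F -> occurs y F -> f x = f y -> x = y) ->
  ok Bs F -> ok Bs (rename f F).
Proof.
  induction F as [x|A IA B IB|A IA]; simpl; intros Hf; auto.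
  - intros [HA HB]; split; [apply IA|apply IB]; auto.
  - intros [HA HN]; split; [now apply IA|].
    destruct A as [x|A B|A]; simpl; auto.
    destruct HN as (H & HS & HV); exists H; split; [exact HS|].
    apply (variant_trans _ _ _ HV), (variant_rename_on f (Neg (Neg A))), Hf.
Qed.

Lemma ok_variant (Bs F G : form) : variant F G -> ok Bs F -> ok Bs G.
Proof. intros (f & Hf & ->); apply ok_rename; auto. Qed.

(* Derivations in tree form, whose deduced formulas contain only double negations
   occurring, up to renaming, in [Bs]. *)
Inductive pr (Bs : form) : form -> Prop :=
| pr_ax F : is_axiom F -> pr Bs F
| pr_cd M C D : pr Bs M -> pr Bs C -> cd M C D -> ok Bs D -> pr Bs D.

Lemma pr_ok (Bs F : form) : pr Bs F -> ok Bs F.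
Proof.
  intros [G (A & HA & HV)|]; [|assumption].
  apply (ok_variant _ _ _ HV); simpl in HA.
  destruct HA as [<-|[<-|[<-|[<-|[]]]]]; simpl; tauto.
Qed.

Lemma pr_variant (Bs F G : form) : pr Bs F -> variant F G -> pr Bs G.
Proof.
  intros HF HV; destruct HF as [F (A & HA & HAF)|M C D HM HC HD HO].
  - apply pr_ax; exists A; split; [exact HA|eapply variant_trans; eauto].
  - apply (pr_cd _ M C G HM HC); [|eapply ok_variant; eauto].
    destruct HD as (f1 & f2 & A & B & s & H1 & H2 & H3 & H4 & H5 & H6).
    exists f1, f2, A, B, s; do 5 (split; [assumption|]).
    eapply variant_trans; eauto.
Qed.

(** * Theorems free of double negations, checked by computation *)

Fixpoint dn_free (F : form) : bool :=
  match F with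
  | Var _ => true
  | Imp A B => dn_free A && dn_free B
  | Neg A => dn_free A && match A with Neg _ => false | _ => true end
  end.

Lemma dn_free_ok (Bs F : form) : dn_free F = true -> ok Bs F.
Proof.
  induction F as [x|A IA B IB|A IA]; simpl; auto; rewrite andb_true_iff;
    intros [H1 H2]; split; auto.
  destruct A; auto; discriminate.
Qed.

Inductive dterm : Type :=
| Ax1 | Ax2 | Ax3 | Ax4
| DD : dterm -> dterm -> dterm.

(** Every intermediate conclusion is tested by [dn_free], so success gives a derivation permitted
    for every [Bs]. *)
Fixpoint eval (d : dterm) : option form :=
  match d with
  | Ax1 => Some A1
  | Ax2 => Some A2
  | Ax3 => Some A3
  | Ax4 => Some A4
  | DD a b =>
      match eval a, eval b with
      | Some M, Some C =>
          match detach M C with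
          | Some D => if dn_free D then Some D else None
          | None => None
          end
      | _, _ => None
      end
  end.

Lemma eval_pr (Bs : form) (d : dterm) : forall F, eval d = Some F -> pr Bs F.
Proof.
  induction d as [| | | |a IA b IB]; simpl; intros F H;
    try (injection H as <-; apply pr_ax; eexists; split; [|apply variant_refl];
         simpl; tauto).
  destruct (eval a) as [M|]; [|discriminate].
  destruct (eval b) as [C|]; [|discriminate].
  destruct (detach M C) as [D|] eqn:HD; [|discriminate].
  destruct (dn_free D) eqn:HF; [|discriminate]; injection H as <-.
  apply (pr_cd _ M C); auto using detach_sound, dn_free_ok.
Qed.

Definition comp (f g : dterm) : dterm := DD (DD Ax2 f) g.

(* i(x,i(i(x,y),y)) *)
Definition tP := DD (DD Ax2 Ax1) Ax3.
(* i(i(x,i(y,z)),i(y,i(x,z))) *)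
Definition tC := DD (DD Ax2 Ax2) (DD Ax2 tP).
Definition tI := DD (DD tC Ax1) Ax1.
(* i(i(y,z),i(i(x,y),i(x,z))) *)
Definition tB := DD tC Ax2.
(* i(i(x,i(y,y)),i(y,y)) *)
Definition tQ := DD Ax3 (DD tP tI).
(* i(i(x,i(y,i(z,z))),i(z,z)) *)
Definition tQ2 := comp (DD tB tQ) tQ.
(* i(a,a) for a = i(x,i(x,y)) *)
Definition tN := DD tQ (DD Ax1 tC).
(** i(i(p,i(p,i(q,q))),i(q,q)): the repeated variable in [tN] identifies the two antecedents
    discarded by [tQ2]. *)
Definition tV := comp tN tQ2.
(* i(a,a) for a = i(i(x,x),x) *)
Definition tO := DD tQ (DD Ax1 Ax3).
Definition tE := DD (DD Ax2 tO) (DD Ax2 Ax1).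
Definition tT := comp (comp Ax2 tB) (DD Ax2 tB).
(* i(i(e,i(x,y)),i(i(y,z),i(e,i(x,z)))) *)
Definition tLC := comp (DD tB Ax2) tC.
Definition tLE := comp tLC tB.
Definition tXl := comp (DD tB Ax2) tLC.
Definition tXr := comp (DD tB tB) tLC.
(* i(n(x),i(x,y)) *)
Definition tF1 := comp Ax1 Ax4.
(* i(n(i(x,x)),y): the negated theorem acts as falsum from here on. *)
Definition tF2 := DD (DD tC tF1) tI.
(* i(i(n(x),n(i(y,y))),x) *)
Definition tF3 := DD (DD tC Ax4) tI.
(* i(i(x,n(i(y,y))),n(x)) *)
Definition tF6 := DD (DD tC (comp (DD Ax2 tF3) Ax3)) tF2.
(** A2 with falsum as its last term becomes contraposition once [tF6] and [tF1] translate between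
    i(x,falsum) and n(x). The next two terms treat i(x,n(y)) and i(n(x),y) in the same spirit
    without passing through a double negation. *)
Definition tCP := comp (comp Ax2 (DD tB tF6)) (DD Ax2 tF1).
Definition tCP1 := comp (comp (DD tB tF1) tC) (DD tB tF6).
Definition tCP2 := comp (comp Ax2 (DD tB tF3)) (DD Ax2 tF1).

Lemma pr_identity (Bs : form) :
  pr Bs (Imp (Var 0) (Var 0)).
Proof. now apply (eval_pr Bs tI). Qed.

Lemma pr_contract_self (Bs : form) :
  pr Bs (Imp (Imp (Var 0) (Imp (Var 0) (Imp (Var 1) (Var 1)))) (Imp (Var 1) (Var 1))).
Proof. now apply (eval_pr Bs tV). Qed.

Lemma pr_expose_var (Bs : form) :
  pr Bs (Imp (Imp (Imp (Var 0) (Var 0)) (Var 0)) (Imp (Var 0) (Var 0))).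
Proof. now apply (eval_pr Bs tE). Qed.

Lemma pr_imp_mono (Bs : form) :
  pr Bs (Imp (Imp (Var 0) (Var 1)) (Imp (Imp (Var 2) (Var 3)) (Imp (Imp (Var 1) (Var 2)) (Imp (Var 0) (Var 3))))).
Proof. now apply (eval_pr Bs tT). Qed.

Lemma pr_chain_under (Bs : form) :
  pr Bs (Imp (Imp (Var 0) (Imp (Var 1) (Var 2))) (Imp (Imp (Var 3) (Imp (Var 2) (Var 4))) (Imp (Var 3) (Imp (Var 0) (Imp (Var 1) (Var 4)))))).
Proof. now apply (eval_pr Bs tLE). Qed.

Lemma pr_expose_left (Bs : form) :
  pr Bs (Imp (Imp (Var 0) (Imp (Var 1) (Var 2))) (Imp (Imp (Imp (Var 1) (Var 3)) (Var 4)) (Imp (Var 0) (Imp (Imp (Var 2) (Var 3)) (Var 4))))).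
Proof. now apply (eval_pr Bs tXl). Qed.

Lemma pr_expose_right (Bs : form) :
  pr Bs (Imp (Imp (Var 0) (Imp (Var 1) (Var 2))) (Imp (Imp (Imp (Var 3) (Var 2)) (Var 4)) (Imp (Var 0) (Imp (Imp (Var 3) (Var 1)) (Var 4))))).
Proof. now apply (eval_pr Bs tXr). Qed.

Lemma pr_contra (Bs : form) :
  pr Bs (Imp (Imp (Var 0) (Var 1)) (Imp (Neg (Var 1)) (Neg (Var 0)))).
Proof. now apply (eval_pr Bs tCP). Qed.

Lemma pr_contra_under (Bs : form) :
  pr Bs (Imp (Imp (Var 0) (Imp (Var 1) (Var 2))) (Imp (Var 0) (Imp (Neg (Var 2)) (Neg (Var 1))))).
Proof. now apply (eval_pr Bs (DD tB tCP)). Qed.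

Lemma pr_contra_neg_r (Bs : form) :
  pr Bs (Imp (Imp (Var 0) (Neg (Var 1))) (Imp (Var 1) (Neg (Var 0)))).
Proof. now apply (eval_pr Bs tCP1). Qed.

Lemma pr_contra_neg_l (Bs : form) :
  pr Bs (Imp (Imp (Neg (Var 0)) (Var 1)) (Imp (Neg (Var 1)) (Var 0))).
Proof. now apply (eval_pr Bs tCP2). Qed.

(** * Derivability of i(a,a) for permitted a *)

Lemma pr_match (Bs A B C D : form) (s : nat -> form) (K : nat) :
  pr Bs (Imp A B) -> pr Bs C -> C = subst s A -> bound C <= K ->
  D = subst (shift_off A s K) B -> ok Bs D -> pr Bs D.
Proof. intros HM HC -> HK -> HD; eauto using pr_cd, cd_match. Qed.

Lemma pr_match_closed (Bs A B C D : form) (s : nat -> form) :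
  pr Bs (Imp A B) -> pr Bs C -> C = subst s A ->
  (forall x, occurs x B -> occurs x A) ->
  D = subst s B -> ok Bs D -> pr Bs D.
Proof.
  intros HM HC EC HV -> HD.
  apply (pr_match Bs A B C _ s (bound C)); auto.
  apply subst_ext; intros x Hx; unfold shift_off.
  destruct (occursbP x A) as [|H]; [reflexivity|now destruct H; apply HV].
Qed.

Definition val (l : list form) (x : nat) : form := nth x l (Var x).

Definition self (A : form) : form := Imp A A.

(** This guard can share [x] with the formula behind it: weakening i(a,a) by A1 would only give a
    fresh antecedent, whereas [tE] yields i(e(x),i(x,x)). *)
Definition expose (x : nat) : form := Imp (Imp (Var x) (Var x)) (Var x).

Lemma pr_self_neg (Bs A : form) :
  pr Bs (self A) -> ok Bs (Neg A) -> pr Bs (self (Neg A)).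
Proof.
  intros HA Hok.
  apply (pr_match_closed Bs (Imp (Var 0) (Var 1))
           (Imp (Neg (Var 1)) (Neg (Var 0))) (self A) _ (val [A; A]));
    try reflexivity; auto.
  - exact (pr_contra Bs).
  - simpl; tauto.
  - now split.
Qed.

Lemma subst_two_fresh (A F G : form) (K i j : nat) :
  bound A <= K ->
  subst (fun v => if v =? i + K then F else if v =? j + K then G else Var v) A = A.
Proof.
  intros HA; apply subst_id; intros v Hv; apply occurs_bound in Hv.
  destruct (Nat.eqb_spec v (i + K)); [lia|].
  destruct (Nat.eqb_spec v (j + K)); [lia|reflexivity].
Qed.

(** The guarded identity on [A] is detached first, leaving two schematic variables; the identity on
    [C] then instantiates just these, so the guard stays tied to [x]. *)
Lemma pr_expose_side (Bs A B : form) (x : nat) (left : bool) :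
  let C := if left then Imp A B else Imp B A in
  occurs x A -> pr Bs (Imp (expose x) (self A)) -> pr Bs (self C) ->
  pr Bs (Imp (expose x) (self C)).
Proof.
  intros C Hx HA HC.
  assert (HokC := pr_ok _ _ HC).
  assert (Hok : ok Bs A) by (subst C; destruct left; simpl in HokC; tauto).
  set (K := bound (Imp (expose x) (self A))).
  assert (HK : bound (Imp (expose x) (self A)) <= K) by apply le_n.
  assert (HKA : bound A <= K) by (unfold K, self; cbn [bound]; lia).
  clearbody K.
  (* [M] has the shape left by the first detachment; [3 + K] and [4 + K] below are variables 3 and 4
     of the theorem used, shifted by the matching. *)
  set (M := fun a b z c : form => if left
    then Imp (Imp (Imp a z) c) (Imp (expose x) (Imp (Imp b z) c))
    else Imp (Imp (Imp z b) c) (Imp (expose x) (Imp (Imp z a) c))).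
  assert (H : pr Bs (M A A (Var (3 + K)) (Var (4 + K)))).
  { subst M; destruct left.
    - refine (pr_match Bs _ _ _ _ (val [expose x; A; A]) K
        (pr_expose_left Bs) HA eq_refl HK eq_refl _); simpl; tauto.
    - refine (pr_match Bs _ _ _ _ (val [expose x; A; A]) K
        (pr_expose_right Bs) HA eq_refl HK eq_refl _); simpl; tauto. }
  set (s := fun v => if v =? 3 + K then B else if v =? 4 + K then C else Var v).
  assert (sA : subst s A = A) by now apply subst_two_fresh.
  assert (s3 : s (3 + K) = B) by (unfold s; now rewrite Nat.eqb_refl).
  assert (s4 : s (4 + K) = C).
  { unfold s; rewrite Nat.eqb_refl.
    destruct (Nat.eqb_spec (4 + K) (3 + K)); [lia|reflexivity]. }
  assert (sx : s x = Var x).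
  { apply occurs_bound in Hx; unfold s.
    destruct (Nat.eqb_spec x (3 + K)), (Nat.eqb_spec x (4 + K));
      solve [lia|reflexivity]. }
  clearbody s; subst M; destruct left;
    refine (pr_match_closed Bs _ _ _ _ s H HC _ _ _ _);
    cbn [subst self expose]; rewrite ?sA, ?s3, ?s4, ?sx; try reflexivity;
    try (simpl in *; tauto);
    intros v; simpl; intuition (subst; tauto).
Qed.

Lemma pr_expose (Bs : form) (x : nat) (A : form) :
  (forall B, subform B A -> pr Bs (self B)) -> occurs x A ->
  pr Bs (Imp (expose x) (self A)).
Proof.
  induction A as [y|A IA B IB|A IA]; intros HS Hx.
  - simpl in Hx; subst y.
    apply (pr_variant Bs (Imp (expose 0) (self (Var 0)))).
    + exact (pr_expose_var Bs).
    + exists (fun v => v + x); split; [intros u v; lia|reflexivity].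
  - destruct Hx as [Hx|Hx].
    + apply (pr_expose_side Bs A B x true); auto using subform.
    + apply (pr_expose_side Bs B A x false); auto using subform.
  - assert (HNA := pr_ok _ _ (HS _ (sub_refl _))).
    refine (pr_match_closed Bs _ _ _ _ (val [expose x; A; A])
      (pr_contra_under Bs) (IA _ Hx) eq_refl _ eq_refl _);
      [auto using subform|simpl; tauto|].
    split; [simpl; tauto|exact HNA].
Qed.

(** With the guards e(y) and e(x) both in front of i(a,a), [pr_contract_self] has to unify them, and
    hence x with y, in one detachment; until then [x] and [y] remain distinct in a. *)
Lemma pr_self_identify (Bs : form) (x y : nat) (A : form) :
  (forall B, subform B A -> pr Bs (self B)) ->
  ok Bs (subst (single y (Var x)) A) ->
  pr Bs (self (subst (single y (Var x)) A)).
Proof.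
  intros HS Hok.
  assert (HA := HS _ (sub_refl A)).
  assert (HokA : ok Bs A) by apply (pr_ok _ _ HA).
  destruct (Nat.eq_dec x y) as [<-|Hxy].
  { rewrite subst_id; [exact HA|]; intros v _; unfold single.
    now destruct (Nat.eqb_spec v x) as [->|]. }
  destruct (occursbP y A) as [Hy|Hy].
  2:{ rewrite subst_id; [exact HA|]; intros v Hv; unfold single.
      destruct (Nat.eqb_spec v y) as [->|]; [contradiction|reflexivity]. }
  destruct (occursbP x A) as [Hx|Hx].
  2:{ apply (pr_variant Bs (self A)); [exact HA|].
      replace (self (subst (single y (Var x)) A))
        with (rename (fun v => if v =? y then x else v) (self A)).
      - apply variant_rename_on; intros u v Hu Hv.
        assert (u <> x) by (intros ->; destruct Hu; auto).
        assert (v <> x) by (intros ->; destruct Hv; auto).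
        destruct (Nat.eqb_spec u y), (Nat.eqb_spec v y); congruence.
      - unfold self, rename; simpl; f_equal; apply subst_ext; intros v _;
          unfold single; now destruct (Nat.eqb_spec v y). }
  assert (Ux := pr_expose Bs x A HS Hx).
  assert (Uy := pr_expose Bs y A HS Hy).
  set (K := bound (Imp (expose x) (self A))).
  assert (HK : bound (Imp (expose x) (self A)) <= K) by apply le_n.
  assert (HKA : bound A <= K) by (unfold K, self; cbn [bound]; lia).
  clearbody K.
  assert (H : pr Bs (Imp (Imp (Var (3 + K)) (Imp A (Var (4 + K))))
    (Imp (Var (3 + K)) (Imp (expose x) (Imp A (Var (4 + K))))))).
  { refine (pr_match Bs _ _ _ _ (val [expose x; A; A]) K
      (pr_chain_under Bs) Ux eq_refl HK eq_refl _); simpl; tauto. }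
  assert (Uyx : pr Bs (Imp (expose y) (Imp (expose x) (self A)))).
  { set (s := fun v =>
      if v =? 3 + K then expose y else if v =? 4 + K then A else Var v) in *.
    assert (sA : subst s A = A) by now apply subst_two_fresh.
    assert (s3 : s (3 + K) = expose y) by (unfold s; now rewrite Nat.eqb_refl).
    assert (s4 : s (4 + K) = A).
    { unfold s; rewrite Nat.eqb_refl.
      destruct (Nat.eqb_spec (4 + K) (3 + K)); [lia|reflexivity]. }
    assert (sx : s x = Var x).
    { apply occurs_bound in Hx; unfold s.
      destruct (Nat.eqb_spec x (3 + K)), (Nat.eqb_spec x (4 + K));
        solve [lia|reflexivity]. }
    clearbody s.
    refine (pr_match_closed Bs _ _ _ _ s H Uy _ _ _ _);
      cbn [subst self expose]; rewrite ?sA, ?s3, ?s4, ?sx; try reflexivity;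
      try (simpl in *; tauto);
      intros v; simpl; intuition (subst; tauto). }
  set (A' := subst (single y (Var x)) A) in *.
  apply (pr_cd Bs (Imp (Imp (Var 0) (Imp (Var 0) (self (Var 1)))) (self (Var 1)))
     (Imp (expose y) (Imp (expose x) (self A)))); [|exact Uyx| |simpl; tauto].
  { exact (pr_contract_self Bs). }
  apply cd_intro with (s1 := val [expose x; A']) (s2 := single y (Var x)).
  - simpl; fold A'; unfold single; rewrite Nat.eqb_refl.
    destruct (Nat.eqb_spec x y); [contradiction|reflexivity].
  - intros t1 t2 E; exists t2; simpl in E.
    injection E as E1 E2 E3 E4.
    (* Both guards match the same variable, so any unifier gives [x] and [y] equal values. *)
    assert (T : forall v, t2 v = subst t2 (single y (Var x) v)).
    { intros v; unfold single; destruct (Nat.eqb_spec v y) as [->|]; simpl; [|auto].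
      rewrite E1 in E2; injection E2; auto. }
    split; [|auto].
    assert (TA : subst t2 A' = subst t2 A).
    { unfold A'; rewrite subst_subst; apply subst_ext; auto. }
    intros v Hv; assert (Hv' : v = 0 \/ v = 1) by (simpl in Hv; tauto).
    destruct Hv' as [-> | ->]; [exact E2|].
    change (t1 1 = subst t2 A'); now rewrite TA.
  - apply variant_refl.
Qed.

(** Detachment with the identity on [B] instantiates only two schematic variables, so those of [A]
    count as fresh and are moved past [K]. *)
Lemma pr_self_imp_apart (Bs A B : form) (K : nat) :
  pr Bs (self A) -> pr Bs (self B) -> bound B <= K ->
  pr Bs (self (Imp (rename (fun x => x + K) A) B)).
Proof.
  intros HA HB HK.
  set (K' := bound (self A)).
  assert (HK' : bound (self A) <= K') by apply le_n.
  assert (HKA : bound A <= K') by (unfold K', self; cbn [bound]; lia).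
  clearbody K'.
  assert (HokA := pr_ok _ _ HA); assert (HokB := pr_ok _ _ HB).
  assert (H : pr Bs (Imp (Imp (Var (2 + K')) (Var (3 + K')))
     (Imp (Imp A (Var (2 + K'))) (Imp A (Var (3 + K')))))).
  { refine (pr_match Bs _ _ _ _ (val [A; A]) K'
      (pr_imp_mono Bs) HA eq_refl HK' eq_refl _); simpl in *; tauto. }
  assert (HR : ok Bs (rename (fun x => x + K) A)).
  { apply ok_rename; [intros; lia|simpl in HokA; tauto]. }
  refine (pr_match Bs _ _ _ _ (fun _ => B) K H HB eq_refl _ _ _).
  - unfold self; cbn [bound]; lia.
  - assert (E : subst (shift_off (Imp (Var (2 + K')) (Var (3 + K'))) (fun _ => B) K) A
      = rename (fun x => x + K) A).
    { apply subst_ext; intros v Hv; apply occurs_bound in Hv.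
      unfold shift_off; cbn [occursb].
      destruct (Nat.eqb_spec v (2 + K')), (Nat.eqb_spec v (3 + K'));
        solve [lia|reflexivity]. }
    cbn [subst]; rewrite E; unfold shift_off; cbn [occursb].
    now rewrite !Nat.eqb_refl, orb_true_r.
  - simpl in *; tauto.
Qed.

Lemma subform_rename (f : nat -> nat) (A B : form) :
  subform B (rename f A) -> exists B', subform B' A /\ B = rename f B'.
Proof.
  induction A as [x|A1 I1 A2 I2|A I]; cbn; intros H; inversion H; subst.
  - exists (Var x); split; [constructor|reflexivity].
  - exists (Imp A1 A2); split; [constructor|reflexivity].
  - destruct I1 as (B' & HB & ->); eauto using subform.
  - destruct I2 as (B' & HB & ->); eauto using subform.
  - exists (Neg A); split; [constructor|reflexivity].
  - destruct I as (B' & HB & ->); eauto using subform.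
Qed.

(* The variables of [A] are kept apart from those of [B] and identified with
   them one at a time, so that each doubly negated subformula always occurs as
   a faithful renaming. *)
Lemma pr_self_imp (Bs A B : form) :
  (forall C, subform C A -> pr Bs (self C)) ->
  (forall C, subform C B -> pr Bs (self C)) ->
  pr Bs (self (Imp A B)).
Proof.
  intros HA HB.
  set (K := max (bound A) (bound B)).
  (* [g k] is the state after [k] identifications: variables below [k] are back in place, the others
     still lie [K] higher. *)
  set (g := fun k x => if x <? k then x else x + K).
  assert (Hg : forall k, k <= K -> forall x y,
    occurs x A -> occurs y A -> g k x = g k y -> x = y).
  { intros k Hk x y Hx Hy; apply occurs_bound in Hx, Hy; unfold g.
    destruct (Nat.ltb_spec x k), (Nat.ltb_spec y k); lia. }
  assert (HokA : ok Bs A) by apply (pr_ok _ _ (HA A (sub_refl _))).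
  assert (HokB : ok Bs B) by apply (pr_ok _ _ (HB B (sub_refl _))).
  assert (H : forall k, k <= K -> pr Bs (self (Imp (rename (g k) A) B))).
  { induction k as [|k IH]; intros Hk.
    - apply pr_self_imp_apart; [auto using subform|auto using subform|lia].
    - assert (E : Imp (rename (g (S k)) A) B =
        subst (single (k + K) (Var k)) (Imp (rename (g k) A) B)).
      { cbn [subst]; f_equal.
        - rewrite subst_rename; apply subst_ext; intros x Hx.
          apply occurs_bound in Hx; unfold g, single.
          destruct (Nat.ltb_spec x (S k)), (Nat.ltb_spec x k);
            destruct (Nat.eqb_spec x (k + K)), (Nat.eqb_spec (x + K) (k + K));
            try (f_equal; lia).
        - symmetry; apply subst_id; intros x Hx; apply occurs_bound in Hx.
          unfold single; destruct (Nat.eqb_spec x (k + K)); [lia|reflexivity]. }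
      rewrite E; apply pr_self_identify.
      + intros C HC; inversion HC as [|C' A' B' HC'|C' A' B' HC'|]; subst.
        * apply IH; lia.
        * apply subform_rename in HC'; destruct HC' as (C' & HC' & ->).
          apply (pr_variant Bs (self C')); [now apply HA|].
          apply (variant_rename_on (g k) (self C')).
          assert (HS : forall x, occurs x (self C') -> occurs x A).
          { intros x Hx; assert (Hx' : occurs x C') by (simpl in Hx; tauto).
            clear - Hx' HC'; induction HC'; simpl; auto. }
          intros x y Hx Hy; apply Hg; auto; lia.
        * now apply HB.
      + rewrite <- E; split; [|exact HokB].
        apply ok_rename; [apply Hg, Hk|exact HokA]. }
  specialize (H K (le_n K)).
  replace (rename (g K) A) with A in H; [exact H|].
  symmetry; apply subst_id; intros x Hx; apply occurs_bound in Hx; unfold g.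
  destruct (Nat.ltb_spec x K); [reflexivity|lia].
Qed.

Lemma pr_self (Bs A : form) : ok Bs A -> pr Bs (self A).
Proof.
  intros Hok.
  enough (H : forall B, subform B A -> pr Bs (self B)) by auto using subform.
  induction A as [x|A1 I1 A2 I2|A I]; intros B HB;
    inversion HB as [|C A' B' HC|C A' B' HC|C A' HC]; subst.
  - apply (pr_variant Bs (self (Var 0))); [apply pr_identity|].
    exists (fun v => v + x); split; [intros u v; lia|reflexivity].
  - simpl in Hok; apply pr_self_imp; tauto.
  - simpl in Hok; intuition.
  - simpl in Hok; intuition.
  - apply pr_self_neg; [|exact Hok].
    simpl in Hok; apply I; [tauto|constructor].
  - simpl in Hok; intuition.
Qed.

(** * Closure under permitted instances and modus ponens *)

Lemma pr_instance (Bs A : form) (s : nat -> form) :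
  pr Bs A -> ok Bs (subst s A) -> pr Bs (subst s A).
Proof.
  intros HA Hok.
  apply (pr_cd Bs (self (subst s A)) A); [now apply pr_self|exact HA| |exact Hok].
  apply cd_instance.
Qed.

Lemma pr_modus_ponens (Bs A B : form) :
  pr Bs (Imp A B) -> pr Bs A -> pr Bs B.
Proof.
  intros HM HA; assert (Hok := pr_ok _ _ HM).
  apply (pr_cd Bs (Imp A B) A); [assumption|assumption| |simpl in Hok; tauto].
  rewrite <- (subst_Var A) at 1; apply cd_instance.
Qed.

(** * Schematic derivations and their stability under [star] *)

Definition opposite (A A' : form) : Prop := A' = Neg A \/ A = Neg A'.

(* [der_contra] subsumes A4 and is stable under removing double negations from
   its instances, which A4 alone is not. *)
Inductive der : form -> Prop :=
| der_A1 A B : der (Imp A (Imp B A))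
| der_A2 A B C : der (Imp (Imp A B) (Imp (Imp B C) (Imp A C)))
| der_A3 A B : der (Imp (Imp (Imp A B) B) (Imp (Imp B A) A))
| der_contra A A' B B' : opposite A A' -> opposite B B' ->
    der (Imp (Imp A B) (Imp B' A'))
| der_mp A B : der (Imp A B) -> der A -> der B.

Lemma opposite_subst (s : nat -> form) (A A' : form) :
  opposite A A' -> opposite (subst s A) (subst s A').
Proof. intros [-> | ->]; [now left|now right]. Qed.

Lemma der_subst (s : nat -> form) (F : form) : der F -> der (subst s F).
Proof.
  induction 1; simpl in *; eauto using der, opposite_subst.
Qed.

Lemma der_axiom (F : form) : is_axiom F -> der F.
Proof.
  intros (A & HA & f & _ & ->); apply der_subst.
  destruct HA as [<-|[<-|[<-|[<-|[]]]]]; try constructor; now right.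
Qed.

Lemma der_cd (M C D : form) : der M -> der C -> cd M C D -> der D.
Proof.
  intros HM HC (f1 & f2 & A & B & s & _ & _ & E & _ & [U _] & (f & _ & ->)).
  apply der_subst, der_mp with (subst s A).
  - apply (der_subst s (Imp A B)); rewrite <- E; now apply der_subst.
  - rewrite U; now do 2 apply der_subst.
Qed.

Lemma nth_error_prefix (P : list (form * just)) (k i : nat) (M : form) :
  nth_error (map fst (firstn k P)) i = Some M ->
  i < k /\ exists j, nth_error P i = Some (M, j).
Proof.
  rewrite nth_error_map, nth_error_firstn.
  destruct (Nat.ltb_spec i k); [|discriminate].
  destruct (nth_error P i) as [[F j]|]; simpl; [|discriminate].
  intros E; injection E as ->; eauto.
Qed.

Lemma der_of_provable (F : form) : provable F -> der F.
Proof.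
  intros (P & HP & j & Hlast).
  enough (H : forall k G j, nth_error P k = Some (G, j) -> der G) by eauto.
  clear F j Hlast.
  induction k as [k IH] using lt_wf_ind; intros G j Hk.
  specialize (HP k _ Hk); unfold line_ok in HP; cbn in HP.
  destruct j as [|i j]; [now apply der_axiom|].
  destruct HP as (M & C & HM & HC & HD).
  apply nth_error_prefix in HM, HC.
  destruct HM as (? & ? & HM), HC as (? & ? & HC); eauto using der_cd.
Qed.

(** Collapsing n(n(q)) exchanges the two formulas of the pair for q, and [opposite] is symmetric. *)
Lemma star_opposite_neg (S : form -> bool) (F : form) :
  opposite (star S F) (star S (Neg F)).
Proof.
  induction F as [x|A IA B IB|A IA IA'] using form_neg_ind;
    [now left|now left|].
  change (star S (Neg (Neg A))) with
    (if S (Neg (Neg A)) then star S A else Neg (star S (Neg A))).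
  destruct (S (Neg (Neg A))); [|now left].
  destruct IA as [E|E]; [right|left]; exact E.
Qed.

Lemma opposite_star (S : form -> bool) (A A' : form) :
  opposite A A' -> opposite (star S A) (star S A').
Proof.
  intros [-> | ->]; [apply star_opposite_neg|].
  destruct (star_opposite_neg S A') as [E|E]; [right|left]; exact E.
Qed.

Lemma der_star (S : form -> bool) (F : form) : der F -> der (star S F).
Proof.
  induction 1; cbn [star] in *; eauto using der, opposite_star.
Qed.

(** * Removing the double negations that are not permitted *)

Fixpoint subformb (G F : form) : bool :=
  (if form_eq_dec G F then true else false) ||
  match F with
  | Var _ => false
  | Imp A B => subformb G A || subformb G B
  | Neg A => subformb G A
  end.

Lemma subformbP (G F : form) : subformb G F = true <-> subform G F.
Proof.
  split.
  - induction F as [x|A IA B IB|A IA]; cbn [subformb];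
      match goal with |- context [form_eq_dec G ?F] =>
        destruct (form_eq_dec G F) as [->|_]; [constructor|] end;
      cbn [orb]; rewrite ?orb_true_iff; intros H.
    + discriminate.
    + destruct H; auto using subform.
    + auto using subform.
  - induction 1 as [F|G A B H IH|G A B H IH|G A H IH].
    + destruct F; cbn [subformb];
        match goal with |- context [form_eq_dec ?F ?F] =>
          now destruct (form_eq_dec F F) end.
    + cbn [subformb]; rewrite IH; apply orb_true_r.
    + cbn [subformb]; rewrite IH, (orb_true_r (subformb G A)); apply orb_true_r.
    + cbn [subformb]; rewrite IH; apply orb_true_r.
Qed.

Definition not_in (Bs G : form) : bool := negb (subformb G Bs).

Lemma star_not_in_id (Bs F : form) : subform F Bs -> star (not_in Bs) F = F.
Proof.
  induction F as [x|A IA B IB|A IA]; intros H; auto.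
  - cbn [star]; f_equal; [apply IA|apply IB]; eapply subform_trans;
      try exact H; auto using subform.
  - assert (EA : star (not_in Bs) A = A).
    { apply IA; eapply subform_trans; try exact H; auto using subform. }
    destruct A as [x|A B|A]; [reflexivity|now rewrite <- EA at 2|].
    change (star (not_in Bs) (Neg (Neg A))) with
      (if not_in Bs (Neg (Neg A)) then star (not_in Bs) A
       else Neg (star (not_in Bs) (Neg A))).
    unfold not_in at 1; apply subformbP in H; rewrite H; simpl negb.
    cbv iota; now rewrite EA.
Qed.

(** A double negation that is kept is a subformula of [Bs], hence unchanged inside; a negated
    variable or implication keeps its shape, so no new double negation arises. *)
Lemma ok_star_not_in (Bs F : form) : ok Bs (star (not_in Bs) F).
Proof.
  induction F as [x|A IA B IB|A IA IA'] using form_neg_ind; simpl; auto.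
  destruct A as [x|A B|A]; simpl; auto.
  destruct (not_in Bs (Neg (Neg A))) eqn:E; [auto|].
  change (ok Bs (Neg (star (not_in Bs) (Neg A)))).
  apply negb_false_iff, subformbP in E.
  rewrite star_not_in_id; [now apply ok_of_subform|].
  eapply subform_trans; [|exact E]; auto using subform.
Qed.

(** Collapsing every formula, cut formulas included, makes each of them permitted, so [pr_instance]
    applies to the axioms. The four combinations of opposites are covered by the three
    contrapositions and A4. *)
Lemma pr_of_der (Bs F : form) : der F -> pr Bs (star (not_in Bs) F).
Proof.
  intros H; assert (Hok := ok_star_not_in Bs F).
  induction H as [A B|A B C|A B|A A' B B' HA HB|A B H1 I1 H2 I2].
  - apply (pr_instance Bs A1 (val [star (not_in Bs) A; star (not_in Bs) B]));
      [now apply (eval_pr Bs Ax1)|exact Hok].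
  - apply (pr_instance Bs A2 (val [star (not_in Bs) A; star (not_in Bs) B;
      star (not_in Bs) C])); [now apply (eval_pr Bs Ax2)|exact Hok].
  - apply (pr_instance Bs A3 (val [star (not_in Bs) A; star (not_in Bs) B]));
      [now apply (eval_pr Bs Ax3)|exact Hok].
  - apply (opposite_star (not_in Bs)) in HA, HB; cbn [star] in *.
    destruct HA as [EA|EA], HB as [EB|EB]; rewrite EA, EB in *.
    + exact (pr_instance Bs _ (val [star (not_in Bs) A; star (not_in Bs) B])
        (pr_contra Bs) Hok).
    + exact (pr_instance Bs _ (val [star (not_in Bs) A; star (not_in Bs) B'])
        (pr_contra_neg_r Bs) Hok).
    + exact (pr_instance Bs _ (val [star (not_in Bs) A'; star (not_in Bs) B])
        (pr_contra_neg_l Bs) Hok).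
    + exact (pr_instance Bs A4 (val [star (not_in Bs) A'; star (not_in Bs) B'])
        (eval_pr Bs Ax4 _ eq_refl) Hok).
  - apply pr_modus_ponens with (star (not_in Bs) A).
    + apply I1, ok_star_not_in.
    + apply I2, ok_star_not_in.
Qed.

(** * From derivation trees to sequences of lines *)

Lemma valid_proof_snoc (P : list (form * just)) (l : form * just) :
  valid_proof P -> line_ok (map fst P) l -> valid_proof (P ++ [l]).
Proof.
  intros HP Hl k l' Hk.
  destruct (Nat.lt_ge_cases k (length P)) as [Hlt|Hge].
  - rewrite nth_error_app1 in Hk by assumption.
    rewrite firstn_app; replace (k - length P) with 0 by lia.
    rewrite app_nil_r; now apply HP.
  - rewrite nth_error_app2 in Hk by assumption.
    destruct (k - length P) as [|m] eqn:E; simpl in Hk;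
      [|now destruct m].
    injection Hk as <-; replace k with (length P) by lia.
    now rewrite firstn_app, firstn_all, Nat.sub_diag, app_nil_r.
Qed.

Lemma nn_controlled_snoc (Bs F : form) (j : just) (P : list (form * just)) :
  nn_controlled P Bs -> (j = JAx \/ ok Bs F) -> nn_controlled (P ++ [(F, j)]) Bs.
Proof.
  intros HP Hj k G i i' Hk.
  destruct (Nat.lt_ge_cases k (length P)) as [Hlt|Hge].
  - rewrite nth_error_app1 in Hk by assumption; now apply (HP k G i i').
  - rewrite nth_error_app2 in Hk by assumption.
    destruct (k - length P) as [|m]; simpl in Hk; [|now destruct m].
    injection Hk as -> ->; destruct Hj as [Hj|Hj]; [discriminate|].
    intros H t HS ->; apply ok_subform with (1 := Hj) in HS; apply HS.
Qed.

(** Quantifying over an initial proof [P] lets the derivations of the two premisses be appended in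
    turn while earlier line numbers keep their meaning. *)
Lemma pr_extend (Bs F : form) : pr Bs F ->
  forall P, valid_proof P -> nn_controlled P Bs ->
  exists Q, valid_proof (P ++ Q) /\ nn_controlled (P ++ Q) Bs /\
    exists j, nth_error (map fst (P ++ Q)) j = Some F.
Proof.
  assert (Last : forall P (F : form) (j : just),
    nth_error (map fst (P ++ [(F, j)])) (length P) = Some F).
  { intros P G j; rewrite map_app, nth_error_app2; rewrite length_map;
      [now rewrite Nat.sub_diag|lia]. }
  induction 1 as [F HF|M C D HM IM HC IC HD Hok]; intros P HP NP.
  - exists [(F, JAx)]; split; [now apply valid_proof_snoc|].
    split; [apply nn_controlled_snoc; auto|eauto].
  - destruct (IM P HP NP) as (Q & HQ & NQ & i & Hi).
    destruct (IC (P ++ Q) HQ NQ) as (R & HR & NR & j & Hj).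
    exists (Q ++ R ++ [(D, JCD i j)]); rewrite !app_assoc.
    split; [|split].
    + apply valid_proof_snoc; [exact HR|].
      exists M, C; split; [|split; assumption].
      rewrite map_app, nth_error_app1; [exact Hi|].
      apply nth_error_Some; congruence.
    + apply nn_controlled_snoc; auto.
    + eauto.
Qed.

Lemma proof_of_pr (Bs F : form) :
  pr Bs F -> exists P, proof_of P F /\ nn_controlled P Bs.
Proof.
  intros H.
  destruct (pr_extend Bs F H []) as (Q & HQ & NQ & j & Hj);
    [intros [|k] l; discriminate|intros [|k] G i j; discriminate|].
  simpl in *; rewrite nth_error_map in Hj.
  destruct (nth_error Q j) as [[G u]|] eqn:E; simpl in Hj; [|discriminate].
  injection Hj as ->.
  assert (Hlt : j < length Q) by (apply nth_error_Some; congruence).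
  (* [proof_of] wants [F] on the last line, so the sequence is cut right after line [j]. *)
  exists (firstn (S j) Q); split; [split|].
  - intros k l Hk; rewrite nth_error_firstn in Hk.
    destruct (Nat.ltb_spec k (S j)); [|discriminate].
    rewrite firstn_firstn; replace (min k (S j)) with k by lia; now apply HQ.
  - exists u; rewrite length_firstn.
    replace (min (S j) (length Q) - 1) with j by lia.
    rewrite nth_error_firstn; destruct (Nat.ltb_spec j (S j)); [exact E|lia].
  - intros k G i i' Hk; rewrite nth_error_firstn in Hk.
    destruct (Nat.ltb_spec k (S j)); [now apply (NQ k G i i')|discriminate].
Qed.

Theorem theorem6 : admits_strong_dne.
Proof.
  intros B HB S _; apply proof_of_pr.
  rewrite <- (star_not_in_id (star S B) (star S B)) at 2 by constructor.
  now apply pr_of_der, der_star, der_of_provable.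
Qed.
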